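(* Let $0<r<1$ and let $\underline{T}=(T_1,\dots,T_d)$ be a doubly commuting tuple of invertible operators acting on a Hilbert space $\mathcal H$. Then the following are equivalent: (1) $T_1,\dots,T_d\in QA_r$; (2) there exist a Hilbert space $\mathcal K$, an isometry $V:\mathcal H\to\mathcal K$ and a doubly commuting tuple $\underline{J}=(J_1,\dots,J_d)$ of invertible operators on $\mathcal K$ such that $T_1^{n_1}\cdots T_d^{n_d}=V^*J_1^{n_1}\cdots J_d^{n_d}V$ for all integers $n_1,\dots,n_d$, and $(r^{-2}+r^2)I_{\mathcal K}-J_m^*J_m-J_m^{-1}J_m^{-*}=0$ for $1\le m\le d$.
   Context: All operators are bounded linear operators on complex Hilbert spaces. $QA_r=\{T: T\text{ invertible},\ \|rT\|\le 1,\ \|rT^{-1}\|\le 1\}$ (the quantum annulus). A tuple $(T_1,\dots,T_d)$ is doubly commuting if $T_iT_j=T_jT_i$ for all $i,j$ and $T_iT_j^*=T_j^*T_i$ for all $i\neq j$. $J^{-*}$ denotes $(J^{-1})^*$. *)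

(* Defs.v *)
From HB Require Import structures.
From mathcomp Require Import all_boot all_order all_algebra.
From mathcomp Require Import complex.
From mathcomp Require Import reals.
Set Implicit Arguments. Unset Strict Implicit. Unset Printing Implicit Defensive.
Import Order.TTheory GRing.Theory Num.Theory.
Local Open Scope ring_scope.

Record hilbert (R : realType) := Hilbert {
  hcar :> lmodType R[i];
  hinner : hcar -> hcar -> R[i];
  hinnerDl : forall (a : R[i]) (x y z : hcar),
      hinner (a *: x + y) z = a * hinner x z + hinner y z;
  hinnerC : forall x y : hcar, hinner y x = (hinner x y)^*;
  hinner_ge0 : forall x : hcar, 0 <= hinner x x;
  hinner_eq0 : forall x : hcar, hinner x x = 0 -> x = 0;
  hcomplete : forall u : nat -> hcar,
      (forall e : R, 0 < e -> exists N : nat, forall m n : nat, (N <= m)%N -> (N <= n)%N ->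
          Num.sqrt (complex.Re (hinner (u m - u n) (u m - u n))) < e) ->
      exists l : hcar, forall e : R, 0 < e -> exists N : nat, forall n : nat, (N <= n)%N ->
          Num.sqrt (complex.Re (hinner (u n - l) (u n - l))) < e
}.

Definition hnorm (R : realType) (H : hilbert R) (x : H) : R :=
  Num.sqrt (complex.Re (hinner x x)).

Definition is_linear (R : realType) (H K : hilbert R) (f : H -> K) :=
  forall (a : R[i]) (x y : H), f (a *: x + y) = a *: f x + f y.

Definition bounded_op (R : realType) (H K : hilbert R) (f : H -> K) :=
  is_linear f /\ exists c : R, forall x : H, hnorm (f x) <= c * hnorm x.

Definition is_adjoint (R : realType) (H K : hilbert R) (T : H -> K) (S : K -> H) :=
  forall (x : H) (y : K), hinner (T x) y = hinner x (S y).

Definition inverse_pair (R : realType) (H : hilbert R) (T Ti : H -> H) :=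
  [/\ bounded_op T, bounded_op Ti, forall x, Ti (T x) = x & forall x, T (Ti x) = x].

Definition is_isometry (R : realType) (H K : hilbert R) (V : H -> K) :=
  is_linear V /\ forall x : H, hnorm (V x) = hnorm x.

(* ||r T|| <= 1, i.e. r ||T x|| <= ||x|| for all x (r > 0) *)
Definition rnorm_le1 (R : realType) (H : hilbert R) (r : R) (T : H -> H) :=
  forall x : H, r * hnorm (T x) <= hnorm x.

Definition in_QA (R : realType) (H : hilbert R) (r : R) (T Ti : H -> H) :=
  rnorm_le1 r T /\ rnorm_le1 r Ti.

Definition doubly_commuting (R : realType) (H : hilbert R) (d : nat) (T : 'I_d -> H -> H) :=
  (forall i j : 'I_d, forall x, T i (T j x) = T j (T i x)) /\
  (forall i j : 'I_d, i != j -> forall S : H -> H, is_adjoint (T j) S ->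
       forall x, T i (S x) = S (T i x)).

Definition zpow (R : realType) (H : hilbert R) (T Ti : H -> H) (n : int) : H -> H :=
  match n with
  | Posz k => iter k T
  | Negz k => iter k.+1 Ti
  end.

Definition multipow (R : realType) (H : hilbert R) (d : nat) (T Ti : 'I_d -> H -> H)
    (n : 'I_d -> int) : H -> H :=
  foldr (fun i f => zpow (T i) (Ti i) (n i) \o f) id (enum 'I_d).

(* Main.v *)
Require Import Defs.
From HB Require Import structures.
From mathcomp Require Import all_boot all_order all_algebra.
From mathcomp Require Import complex.
From mathcomp Require Import reals.
From mathcomp Require Import boolp classical_sets ring lra.
Import Order.TTheory GRing.Theory Num.Theory.
Local Open Scope ring_scope.

(* If A = T^* T satisfies r^2 <= A <= r^-2, then (r^2 + r^-2) A - A^2 - 1 is positive and has a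
   square root B commuting with everything that commutes with A.  The operator
     J = [ T   T^{-*} B ]
         [ 0   T^{-*}   ]
   on H + H extends T, and J^* J = [ A  B ; B  r^2 + r^-2 - A ] has "trace" r^2 + r^-2 and
   "determinant" 1, so J^* J + (J^* J)^{-1} = r^2 + r^-2.  The other T_j lift to T_j + T_j, which
   doubly commute with J; so the d operators can be treated one after the other, and since
   extensions respect all integer powers, an isometric extension is a dilation.  Conversely the
   equation for J forces the spectrum of J^* J into {r^2, r^-2}, and compressing J and J^{-1}
   preserves norm bounds.  All computations use the real inner product Re <x, y>: vector
   identities are tested against an arbitrary vector and become ring identities. *)

(** * The real inner product [Re <x, y>] and its arithmetic *)

Section RealInnerProduct.
Set Implicit Arguments. Unset Strict Implicit.
Variables (R : realType) (H : hilbert R).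
Implicit Types (x y z : H) (a : R).

Definition ip x y : R := complex.Re (hinner x y).
Definition nsq x : R := ip x x.

Lemma ipC x y : ip x y = ip y x.
Proof. by rewrite /ip (hinnerC y x); case: (hinner y x). Qed.

Lemma ipDl x y z : ip (x + y) z = ip x z + ip y z.
Proof.
rewrite /ip -[x]scale1r hinnerDl mul1r scale1r.
by case: (hinner x z) (hinner y z) => [? ?] [? ?].
Qed.

Lemma ip0l z : ip 0 z = 0.
Proof. by have := ipDl 0 0 z; rewrite addr0 => h; lra. Qed.

Lemma hinnerZl (b : R[i]) x z : hinner (b *: x) z = b * hinner x z.
Proof.
have h0 : hinner 0 z = 0 by have := hinnerDl (-1) z z z; rewrite scaleN1r addNr mulN1r addNr.
by rewrite -[_ *: x]addr0 hinnerDl h0 addr0.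
Qed.

Lemma ipZl a x z : ip ((a%:C)%C *: x) z = a * ip x z.
Proof. by rewrite /ip hinnerZl; case: (hinner x z) => [? ?] /=; rewrite mul0r subr0. Qed.

Lemma ipNl x z : ip (- x) z = - ip x z.
Proof. by have := ipDl (- x) x z; rewrite addNr ip0l => h; lra. Qed.

Lemma ipDr x y z : ip z (x + y) = ip z x + ip z y.
Proof. by rewrite ipC ipDl !(ipC _ z). Qed.

Lemma ip0r z : ip z 0 = 0.
Proof. by rewrite ipC ip0l. Qed.

Lemma ipZr a x z : ip z ((a%:C)%C *: x) = a * ip z x.
Proof. by rewrite ipC ipZl ipC. Qed.

Lemma ipNr x z : ip z (- x) = - ip z x.
Proof. by rewrite ipC ipNl ipC. Qed.

Definition ipE := (ipDl, ipDr, ipNl, ipNr, ipZl, ipZr, ip0l, ip0r).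

Lemma nsq_ge0 x : 0 <= nsq x.
Proof.
by have := hinner_ge0 x; rewrite /nsq /ip; case: (hinner x x) => [u v]; rewrite lecE /= => /andP[].
Qed.

Lemma nsq_eq0 x : nsq x = 0 -> x = 0.
Proof.
move=> h; apply: hinner_eq0; have := hinner_ge0 x; move: h.
rewrite /nsq /ip; case: (hinner x x) => [u v]; rewrite lecE /= => -> /andP[/eqP -> _].
by [].
Qed.

(** Real parts already separate points: taking [z := x - y] makes the squared norm of [x - y]
    vanish. *)
Lemma vec_eq x y : (forall z, ip x z = ip y z) -> x = y.
Proof.
move=> h; apply/subr0_eq/nsq_eq0; rewrite /nsq ipDl ipNl h; lra.
Qed.

Lemma nsqD x y : nsq (x + y) = nsq x + 2 * ip x y + nsq y.
Proof. by rewrite /nsq !ipE (ipC y x); ring. Qed.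

Lemma nsqN x : nsq (- x) = nsq x.
Proof. by rewrite /nsq !ipE; ring. Qed.

Lemma nsqB x y : nsq (x - y) = nsq x - 2 * ip x y + nsq y.
Proof. by rewrite nsqD nsqN ipNr; ring. Qed.

Lemma nsqZ a x : nsq ((a%:C)%C *: x) = a ^+ 2 * nsq x.
Proof. by rewrite /nsq !ipE; ring. Qed.

Lemma nsqD_le x y : nsq (x + y) <= 2 * nsq x + 2 * nsq y.
Proof. by have := nsq_ge0 (x - y); rewrite nsqB nsqD => h; lra. Qed.

Lemma hnorm_sq x : hnorm x ^+ 2 = nsq x.
Proof. by rewrite /hnorm sqr_sqrtr //; exact: nsq_ge0. Qed.

Lemma hnorm_ge0 x : 0 <= hnorm x.
Proof. exact: sqrtr_ge0. Qed.

End RealInnerProduct.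

(** The common source of all Cauchy-Schwarz type estimates below. For [c != 0] evaluate at the
    minimiser [t = - b / c]; for [c = 0] and [b != 0] the point chosen makes the affine function
    equal to -1. *)
Lemma discriminant_le (R : realType) (a b c : R) :
  0 <= c -> (forall t : R, 0 <= a + 2 * t * b + t ^+ 2 * c) -> b ^+ 2 <= a * c.
Proof.
move=> c0 h; have [cE|cN0] := eqVneq c 0.
  have [->|bN0] := eqVneq b 0; first by rewrite cE expr0n /= mulr0.
  have := h (- (a + 1) / (2 * b)); rewrite cE mulr0 addr0.
  have -> : 2 * (- (a + 1) / (2 * b)) * b = - (a + 1) by field.
  by move=> ?; lra.
have cp : 0 < c by rewrite lt0r cN0.
have := h (- b / c).
have -> : a + 2 * (- b / c) * b + (- b / c) ^+ 2 * c = (a * c - b ^+ 2) / c by field.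
by rewrite pmulr_lge0 ?invr_gt0 // subr_ge0.
Qed.

(** * Limits in a Hilbert space and the Riesz representation *)

Section Limits.
Set Implicit Arguments. Unset Strict Implicit.
Variables (R : realType).

Lemma ip_cauchy (H : hilbert R) (x y : H) : ip x y ^+ 2 <= nsq x * nsq y.
Proof.
apply: discriminant_le (nsq_ge0 _) _ => t.
by have := nsq_ge0 (x + (t%:C)%C *: y); rewrite nsqD nsqZ ipZr => h; lra.
Qed.

Definition cvg_to (H : hilbert R) (u : nat -> H) (l : H) :=
  forall e : R, 0 < e -> exists N : nat, forall n, (N <= n)%N -> nsq (u n - l) < e.

Lemma hilbert_complete (H : hilbert R) (u : nat -> H) :
  (forall e : R, 0 < e -> exists N : nat, forall m n, (N <= m)%N -> (N <= n)%N ->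
     nsq (u m - u n) < e) -> exists l, cvg_to u l.
Proof.
have sq (x : H) (e : R) : 0 < e -> (Num.sqrt (complex.Re (hinner x x)) < e) = (nsq x < e ^+ 2).
  by move=> e0; rewrite -hnorm_sq ltr_pXn2r ?nnegrE ?hnorm_ge0 ?(ltW e0).
move=> hu; have [|l hl] := @hcomplete _ H u.
  move=> e e0; have [N hN] := hu (e ^+ 2) (exprn_gt0 _ e0).
  by exists N => m n hm hn; rewrite sq // hN.
exists l => e e0; have s0 : 0 < Num.sqrt e by rewrite sqrtr_gt0.
have [N hN] := hl _ s0; exists N => n /hN; rewrite sq // sqr_sqrtr //; exact: ltW.
Qed.

Lemma le_eps (a b k : R) : 0 <= k -> (forall e, 0 < e -> a <= b + k * e) -> a <= b.
Proof.
move=> k0 h; rewrite leNgt; apply/negP => ab.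
have kp : 0 < 2 * (k + 1) by lra.
have e0 : 0 < (a - b) / (2 * (k + 1)) by rewrite divr_gt0 // subr_gt0.
have := h _ e0.
have : k * ((a - b) / (2 * (k + 1))) <= (a - b) / 2.
  have -> : (a - b) / 2 = (k + 1) * ((a - b) / (2 * (k + 1))).
    by field; lra.
  by apply: ler_wpM2r; [exact: ltW|lra].
by move=> ? ?; lra.
Qed.

Lemma cvg_to_uniq (H : hilbert R) (u : nat -> H) k l : cvg_to u k -> cvg_to u l -> k = l.
Proof.
move=> hk hl; apply/subr0_eq/nsq_eq0/eqP; rewrite eq_le nsq_ge0 andbT.
apply: (@le_eps _ _ 4) => // e e0.
have [N hN] := hk e e0; have [M hM] := hl e e0.
have {hN} := hN (maxn N M) (leq_maxl _ _); have {hM} := hM (maxn N M) (leq_maxr _ _).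
set v := u _ => h1 h2.
have -> : k - l = (v - l) + - (v - k) by apply: vec_eq => z; rewrite !ipE; ring.
by have := nsqD_le (v - l) (- (v - k)); rewrite nsqN => ?; lra.
Qed.

Lemma cvg_toD (H : hilbert R) (u v : nat -> H) k l :
  cvg_to u k -> cvg_to v l -> cvg_to (fun n => u n + v n) (k + l).
Proof.
move=> hk hl e e0; have e4 : 0 < e / 4 by lra.
have [N hN] := hk _ e4; have [M hM] := hl _ e4; exists (maxn N M) => n.
rewrite geq_max => /andP[/hN h1 /hM h2].
have -> : u n + v n - (k + l) = (u n - k) + (v n - l) by apply: vec_eq => z; rewrite !ipE; ring.
by have := nsqD_le (u n - k) (v n - l) => ?; lra.
Qed.

Lemma cvg_to_cst (H : hilbert R) (l : H) : cvg_to (fun=> l) l.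
Proof. by move=> e e0; exists 0%N => n _; rewrite subrr /nsq ip0l. Qed.

Lemma cvg_to_shift (H : hilbert R) (u : nat -> H) l : cvg_to u l -> cvg_to (fun n => u n.+1) l.
Proof. by move=> h e /h[N hN]; exists N => n hn; apply/hN/leqW. Qed.

Lemma cvg_to_ip (H : hilbert R) (u : nat -> H) l x (e : R) : cvg_to u l -> 0 < e ->
  exists N : nat, forall n, (N <= n)%N -> `|ip (u n) x - ip l x| < e.
Proof.
move=> hu e0; have n0 := nsq_ge0 x.
have n1 : 0 < nsq x + 1 by lra.
have [N hN] := hu (e ^+ 2 / (nsq x + 1)) (divr_gt0 (exprn_gt0 _ e0) n1).
exists N => n /hN h; have -> : ip (u n) x - ip l x = ip (u n - l) x by rewrite !ipE.
rewrite -(@ltr_pXn2r _ 2) ?nnegrE ?(ltW e0) // real_normK ?num_real //.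
apply: le_lt_trans (ip_cauchy _ _) _.
rewrite ltr_pdivlMr // in h; apply: le_lt_trans h.
by apply: ler_wpM2l; rewrite ?nsq_ge0 // lerDl.
Qed.

Lemma cvg_to_ip_le (H : hilbert R) (u : nat -> H) l x b : cvg_to u l ->
  (forall n, ip (u n) x <= b) -> ip l x <= b.
Proof.
move=> hu hb; apply: (@le_eps _ _ 1) => // e e0.
have [N hN] := cvg_to_ip x hu e0; have := hb N; have := hN N (leqnn _).
by rewrite ltr_norml => /andP[? ?] ?; lra.
Qed.

Lemma cvg_to_nsq_le (H : hilbert R) (u : nat -> H) l b : cvg_to u l ->
  (forall n, nsq (u n) <= b) -> nsq l <= b.
Proof.
(* Each [ip (u n) l] is at most the mean of [nsq (u n)] and [nsq l]; in the limit half of [nsq l] is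
   absorbed on the left. *)
move=> hu hb; have : ip l l <= (b + nsq l) / 2.
  apply: cvg_to_ip_le hu _ => n.
  by have := hb n; have := nsq_ge0 (u n - l); rewrite nsqB => ? ?; lra.
by rewrite -/(nsq l) => ?; lra.
Qed.

Lemma monotone_cauchy (a : nat -> R) (b : R) :
  (forall n, a n <= a n.+1) -> (forall n, a n <= b) ->
  forall e, 0 < e -> exists N : nat, forall n, (N <= n)%N -> a n - a N < e.
Proof.
move=> amon ab e e0; pose A := range a.
have supA : has_sup A.
  by split; [exists (a 0%N), 0%N | exists b => _ [n _ <-]].
have [_ [N _ <-] hN] := sup_adherent e0 supA.
exists N => n _; have : a n <= sup A by apply: sup_upper_bound => //; exists n.
by move=> ?; lra.
Qed.

(** The representing vector is the maximiser of the concave functional [phi x = 2 f x - nsq x]: a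
    maximising sequence is Cauchy, and first-order optimality at its limit gives [f = ip v]. Only
    real linearity matters because [ip] is the real part. *)
Lemma riesz (H : hilbert R) (f : H -> R) (c : R) :
  (forall x y, f (x + y) = f x + f y) -> (forall (a : R) x, f ((a%:C)%C *: x) = a * f x) ->
  0 <= c -> (forall x, f x ^+ 2 <= c * nsq x) -> exists v, forall x, f x = ip v x.
Proof.
move=> fD fZ c0 fc.
pose phi x := 2 * f x - nsq x.
pose A := range phi.
have supA : has_sup A.
  split; first by exists (phi 0), 0.
  (* [(2 f x)^2 <= 4 c nsq x <= (c + nsq x)^2], the second inequality because [(c - nsq x)^2] is
     nonnegative. *)
  exists c => _ [x _ <-]; rewrite /phi lerBlDr.
  have n0 := nsq_ge0 x; apply: le_trans (ler_norm _) _.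
  rewrite -(@ler_pXn2r _ 2) ?nnegrE ?addr_ge0 // real_normK ?num_real //.
  by have := fc x; have := sqr_ge0 (c - nsq x); rewrite !expr2 => ? ?; lra.
have [d d0 d_lt] : exists2 d : nat -> R, forall n, 0 < d n &
    forall e : R, 0 < e -> exists N : nat, forall n, (N <= n)%N -> d n < e.
  exists (fun n => n.+1%:R^-1) => [n|e e0]; first by rewrite invr_gt0 ltr0Sn.
  exists (Num.bound e^-1) => n hn; rewrite invf_plt ?posrE ?ltr0Sn //.
  apply: lt_le_trans (archi_boundP _) _; first by rewrite invr_ge0 ltW.
  by rewrite ler_nat leqW.
have [u hu] : exists u : nat -> H, forall n, sup A - d n < phi (u n).
  suff /choice[u hu] : forall n : nat, exists x, sup A - d n < phi x by exists u.
  by move=> n; have [_ [x _ <-] hx] := sup_adherent (d0 n) supA; exists x.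
have phi_le x : phi x <= sup A by apply: sup_upper_bound => //; exists x.
have [|v hv] := @hilbert_complete H u.
  move=> e e0; have e4 : 0 < e / 4 by lra.
  have [N hN] := d_lt _ e4; exists N => m n /hN hm /hN hn.
  have hum := hu m; have hun := hu n.
  (* By the parallelogram law, [phi] at the midpoint exceeds the mean of [phi (u m)] and [phi (u n)]
     by [nsq (u m - u n) / 4], so two nearly maximal points are close. *)
  have hs : phi (((2^-1 : R)%:C)%C *: (u m + u n)) <= sup A := phi_le _.
  rewrite /phi fZ fD nsqZ nsqD in hs; rewrite /phi in hum hun.
  have q4 : (2^-1 : R) ^+ 2 = (4^-1 : R) by field.
  rewrite q4 in hs.
  by rewrite nsqB; lra.
(* Moving [u n] by [t x] can raise [phi] by at most [d n], for every [t]; this is a nonnegative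
   quadratic in [t]. *)
have approx n x : (ip (u n) x - f x) ^+ 2 <= d n * nsq x.
  apply: discriminant_le (nsq_ge0 _) _ => t.
  have := phi_le (u n + (t%:C)%C *: x); have := hu n.
  by rewrite /phi fD fZ nsqD nsqZ ipZr => h1 h2; lra.
exists v => x; apply/eqP; rewrite -subr_eq0 -sqrf_eq0 eq_le sqr_ge0 andbT.
have n0 := nsq_ge0 x.
apply: (@le_eps _ _ (2 * nsq x + 2)) => [|e e0]; first by lra.
have s0 : 0 < Num.sqrt e by rewrite sqrtr_gt0.
have [N hN] := d_lt _ e0; have [M hM] := cvg_to_ip x hv s0.
have {hN} := hN (maxn N M) (leq_maxl _ _); have {hM} := hM (maxn N M) (leq_maxr _ _).
set n := maxn N M => h1 h2.
have h3 : (ip (u n) x - ip v x) ^+ 2 <= e.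
  rewrite -(sqr_sqrtr (ltW e0)) -real_normK ?num_real //.
  by rewrite ler_pXn2r ?nnegrE ?(ltW s0) // ltW.
have h4 : (ip (u n) x - f x) ^+ 2 <= (e * nsq x : R).
  by apply: le_trans (approx n x) _; rewrite ler_wpM2r // ltW.
have := sqr_ge0 ((ip (u n) x - f x) + (ip (u n) x - ip v x)).
by rewrite !expr2 in h3 h4 * => ?; lra.
Qed.

End Limits.

(** * Bounded operators and their adjoints *)

Section Operators.
Set Implicit Arguments. Unset Strict Implicit.
Variables (R : realType).
Implicit Types (H K L : hilbert R).

Section Linear.
Variables (H K : hilbert R) (T : H -> K).
Hypothesis linT : is_linear T.

Lemma lin0 : T 0 = 0.
Proof.
have := linT 1 0 0; rewrite !scale1r !addr0 => h.
by apply: (addrI (T 0)); rewrite -h addr0.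
Qed.

Lemma linD x y : T (x + y) = T x + T y.
Proof. by rewrite -[x in LHS]scale1r linT scale1r. Qed.

Lemma linZ a x : T (a *: x) = a *: T x.
Proof. by rewrite -[_ *: x]addr0 linT lin0 addr0. Qed.

Lemma linN x : T (- x) = - T x.
Proof. by rewrite -scaleN1r linZ scaleN1r. Qed.

Definition linE := (linD, linN, linZ, lin0).
End Linear.

Lemma lin_comp H K L (S : K -> L) (T : H -> K) :
  is_linear S -> is_linear T -> is_linear (fun x => S (T x)).
Proof. by move=> hS hT a x y; rewrite hT hS. Qed.

Lemma lin_add H K (S T : H -> K) :
  is_linear S -> is_linear T -> is_linear (fun x => S x + T x).
Proof. by move=> hS hT a x y; rewrite hT hS scalerDr addrACA. Qed.

Lemma lin_scale H K (b : R[i]) (T : H -> K) : is_linear T -> is_linear (fun x => b *: T x).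
Proof. by move=> hT a x y; rewrite hT scalerDr !scalerA mulrC. Qed.

Lemma lin_id H : is_linear (fun x : H => x).
Proof. by []. Qed.

Lemma bounded_nsq H K (T : H -> K) :
  bounded_op T <-> is_linear T /\ exists2 c : R, 0 <= c & forall x, nsq (T x) <= c * nsq x.
Proof.
split=> -[linT [c]]; [move=> hc|move=> c0 hc]; split=> //.
  exists (c ^+ 2); first exact: sqr_ge0.
  move=> x; rewrite -!hnorm_sq -exprMn ler_pXn2r ?nnegrE ?hnorm_ge0 //.
  exact: le_trans (hnorm_ge0 _) (hc x).
exists (Num.sqrt c) => x.
rewrite -(@ler_pXn2r _ 2) ?nnegrE ?hnorm_ge0 ?mulr_ge0 ?sqrtr_ge0 ?hnorm_ge0 //.
by rewrite exprMn !hnorm_sq sqr_sqrtr.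
Qed.

Lemma bounded_comp H K L (S : K -> L) (T : H -> K) :
  bounded_op S -> bounded_op T -> bounded_op (fun x => S (T x)).
Proof.
move=> /bounded_nsq[lS [c c0 hc]] /bounded_nsq[lT [d d0 hd]]; apply/bounded_nsq.
split; first exact: lin_comp.
exists (c * d); first exact: mulr_ge0.
by move=> x; apply: le_trans (hc _) _; rewrite -mulrA ler_wpM2l.
Qed.

Lemma bounded_add H K (S T : H -> K) :
  bounded_op S -> bounded_op T -> bounded_op (fun x => S x + T x).
Proof.
move=> /bounded_nsq[lS [c c0 hc]] /bounded_nsq[lT [d d0 hd]]; apply/bounded_nsq.
split; first exact: lin_add.
exists (2 * c + 2 * d); first by lra.
by move=> x; have := hc x; have := hd x; have := nsqD_le (S x) (T x) => ? ? ?; lra.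
Qed.

Lemma nsqZC H (a : R[i]) (x : H) :
  nsq (a *: x) = (complex.Re a ^+ 2 + complex.Im a ^+ 2) * nsq x.
Proof.
rewrite /nsq /ip hinnerZl (hinnerC (a *: x) x) hinnerZl.
have := hinner_ge0 x; case: (hinner x x) (a) => [u v] [p q].
by rewrite lecE /= => /andP[/eqP -> _]; ring.
Qed.

Lemma bounded_scale H K (b : R[i]) (T : H -> K) :
  bounded_op T -> bounded_op (fun x => b *: T x).
Proof.
move=> /bounded_nsq[lT [c c0 hc]]; apply/bounded_nsq; split; first exact: lin_scale.
have b0 : 0 <= complex.Re b ^+ 2 + complex.Im b ^+ 2 by rewrite addr_ge0 ?sqr_ge0.
exists ((complex.Re b ^+ 2 + complex.Im b ^+ 2) * c); first exact: mulr_ge0.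
by move=> x; rewrite nsqZC -mulrA ler_wpM2l.
Qed.

Lemma bounded_id H : bounded_op (fun x : H => x).
Proof. by apply/bounded_nsq; split=> //; exists 1 => // x; rewrite mul1r. Qed.

(** The imaginary part of [<x, y>] is minus the real part of [<i x, y>], so the real identity at [x]
    and at [i x] yields the complex one. *)
Lemma adjoint_ip H K (T : H -> K) S :
  is_linear T -> (forall x y, ip (T x) y = ip x (S y)) -> is_adjoint T S.
Proof.
move=> lT h x y.
have hi (L : hilbert R) (u v : L) : complex.Im (hinner u v) = - ip ('i%C *: u) v.
  by rewrite /ip hinnerZl; case: (hinner u v) => p q /=; ring.
have := h x y; have := h ('i%C *: x) y; rewrite (linZ lT) => h1 h2.
have := hi _ (T x) y; rewrite h1 -hi; move: h2; rewrite /ip.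
by case: (hinner _ _) (hinner _ _) => p q [p' q'] /= -> ->.
Qed.

Lemma adjointE H K (T : H -> K) S x y : is_adjoint T S -> ip (T x) y = ip x (S y).
Proof. by move=> h; rewrite /ip h. Qed.

(** Riesz applied to [x => ip (T x) y] for each [y], followed by choice. *)
Lemma adjoint_exists H K (T : H -> K) : bounded_op T -> exists S, is_adjoint T S.
Proof.
move=> /bounded_nsq[lT [c c0 hc]].
suff /choice[S hS] : forall y, exists v, forall x, ip (T x) y = ip v x.
  by exists S; apply: adjoint_ip => // x y; rewrite hS ipC.
move=> y; apply: (@riesz _ _ (fun x => ip (T x) y) (c * nsq y)).
- by move=> u v; rewrite (linD lT) ipDl.
- by move=> a x; rewrite (linZ lT) ipZl.
- by rewrite mulr_ge0 ?nsq_ge0.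
- move=> x; apply: le_trans (ip_cauchy _ _) _.
  by rewrite mulrAC ler_wpM2r ?nsq_ge0.
Qed.

Lemma adjoint_sym H K (T : H -> K) S : is_adjoint T S -> is_adjoint S T.
Proof. by move=> h x y; rewrite hinnerC -h -hinnerC. Qed.

Lemma adjoint_unique H K (T : H -> K) S S' y : is_adjoint T S -> is_adjoint T S' -> S y = S' y.
Proof.
move=> h h'; apply: vec_eq => z.
by rewrite ipC -(adjointE _ _ h) (adjointE _ _ h') ipC.
Qed.

Lemma hinner_ndeg H (x y : H) : (forall z, hinner x z = hinner y z) -> x = y.
Proof. by move=> h; apply: vec_eq => z; rewrite /ip h. Qed.

Lemma adjoint_linear H K (T : H -> K) S : is_adjoint T S -> is_linear S.
Proof.
move=> /adjoint_sym h a x y; apply: hinner_ndeg => z.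
by rewrite h hinnerDl -!h -hinnerDl.
Qed.

Lemma adjoint_bounded H K (T : H -> K) S : bounded_op T -> is_adjoint T S -> bounded_op S.
Proof.
move=> /bounded_nsq[lT [c c0 hc]] h; apply/bounded_nsq; split; first exact: adjoint_linear h.
exists c => // y; have [->|nz] := eqVneq (nsq (S y)) 0; first by rewrite mulr_ge0 ?nsq_ge0.
have np : 0 < nsq (S y) by rewrite lt0r nz nsq_ge0.
(* [nsq (S y) ^ 2 = ip (T (S y)) y ^ 2 <= c * nsq (S y) * nsq y], and one factor [nsq (S y)]
   cancels. *)
rewrite -(ler_pM2l np).
have {1 2}-> : nsq (S y) = ip (T (S y)) y by rewrite (adjointE _ _ h).
rewrite -expr2; apply: le_trans (ip_cauchy _ _) _.
by rewrite mulrA (mulrC (nsq (S y))) ler_wpM2r ?nsq_ge0.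
Qed.

Lemma adjoint_comp H K L (S : K -> L) (T : H -> K) Sa Ta :
  is_adjoint S Sa -> is_adjoint T Ta -> is_adjoint (fun x => S (T x)) (fun y => Ta (Sa y)).
Proof. by move=> hS hT x y; rewrite hS hT. Qed.

Lemma adjoint_commute H (S T Sa Ta : H -> H) : is_adjoint S Sa -> is_adjoint T Ta ->
  (forall x, S (T x) = T (S x)) -> forall x, Sa (Ta x) = Ta (Sa x).
Proof.
move=> hS hT com x; apply: (@adjoint_unique _ _ (fun x => T (S x)) (fun y => Sa (Ta y)) (fun y => Ta (Sa y))).
  exact: adjoint_comp.
by move=> u v; rewrite -com; apply: (adjoint_comp hS hT).
Qed.

End Operators.

(** * The square root of [1 - C] for a positive contraction [C] *)

Section SquareRoot.
Set Implicit Arguments. Unset Strict Implicit.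
Variables (R : realType) (H : hilbert R) (C : H -> H).
Hypothesis linC : is_linear C.
Hypothesis selfC : is_adjoint C C.
Hypothesis posC : forall x, 0 <= ip (C x) x.
Hypothesis ctrC : forall x, nsq (C x) <= nsq x.

(* Polynomials in C with nonnegative coefficients. *)
Inductive cone : (H -> H) -> Prop :=
| cone_id : cone (fun x => x)
| cone_mul f : cone f -> cone (fun x => C (f x))
| cone_add f g : cone f -> cone g -> cone (fun x => f x + g x)
| cone_scale (a : R) f : 0 <= a -> cone f -> cone (fun x => (a%:C)%C *: f x)
| cone_ext f g : cone f -> f =1 g -> cone g.

Lemma cone_comp f g : cone f -> cone g -> cone (fun x => f (g x)).
Proof.
move=> cf cg; elim: cf => {f} [|f _ h|f f' _ h _ h'|a f a0 _ h|f f' _ h e].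
- exact: cg.
- exact: (cone_mul h).
- exact: (cone_add h h').
- exact: (cone_scale a0 h).
- by apply: cone_ext h _ => x; rewrite e.
Qed.

Lemma cone_linear f : cone f -> is_linear f.
Proof.
elim=> {f} [|f _ h|f f' _ h _ h'|a f a0 _ h|f f' _ h e]; first exact: lin_id.
- exact: lin_comp.
- exact: lin_add.
- exact: lin_scale.
- by move=> a x y; rewrite -!e h.
Qed.

Lemma cone_commute (X : H -> H) f : is_linear X -> (forall x, X (C x) = C (X x)) ->
  cone f -> forall x, X (f x) = f (X x).
Proof.
move=> lX com; elim=> {f} [|f _ h|f f' _ h _ h'|a f a0 _ h|f f' _ h e] x //.
- by rewrite com h.
- by rewrite (linD lX) h h'.
- by rewrite (linZ lX) h.
- by rewrite -!e h.
Qed.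

Lemma cone_commuteC f x : cone f -> C (f x) = f (C x).
Proof. by move=> cf; apply: cone_commute cf x. Qed.

Lemma cone_commute2 f g x : cone f -> cone g -> f (g x) = g (f x).
Proof.
move=> cf cg; apply: (cone_commute (cone_linear cf) _ cg) => y.
by rewrite cone_commuteC.
Qed.

Lemma cone_selfadjoint f x y : cone f -> ip (f x) y = ip x (f y).
Proof.
move=> cf; elim: cf x y => {f} [|f cf h|f f' _ h _ h'|a f a0 _ h|f f' _ h e] x y //.
- by rewrite (adjointE _ _ selfC) h cone_commuteC.
- by rewrite !ipE h h'.
- by rewrite !ipE h.
- by rewrite -!e h.
Qed.

(* Positivity of C \o f is C \o C \o f tested against x, i.e. f tested against C x, so f and C \o f are treated together. *)
Lemma cone_pos f x : cone f -> 0 <= ip (f x) x.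
Proof.
move=> cf; suff /(_ x)[] : forall x, 0 <= ip (f x) x /\ 0 <= ip (C (f x)) x by [].
elim: cf => {f x} [|f cf h|f f' _ h _ h'|a f a0 _ h|f f' _ h e] x.
- by split; [exact: nsq_ge0 | exact: posC].
- split; first by case: (h x).
  by rewrite (adjointE _ _ selfC) cone_commuteC //; case: (h (C x)).
- by rewrite (linD linC) !ipE; case: (h x) (h' x) => ? ? [? ?]; split; apply: addr_ge0.
- by rewrite (linZ linC) !ipE; case: (h x) => ? ?; split; apply: mulr_ge0.
- by rewrite -e.
Qed.

(** A fixed point [Y] of [Y = (C + Y^2) / 2] satisfies [(1 - Y)^2 = 1 - C]. Starting from 0 keeps
    every iterate in [cone]. *)
Fixpoint sqrt_iter (n : nat) (x : H) : H :=
  if n is m.+1 then ((2^-1 : R)%:C)%C *: (C x + sqrt_iter m (sqrt_iter m x)) else 0.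

Lemma half_ge0 : 0 <= (2^-1 : R).
Proof. by rewrite invr_ge0 ler0n. Qed.

Lemma cone_iter n : cone (sqrt_iter n).
Proof.
elim: n => [|n h].
  by apply: (cone_ext (cone_scale (lexx 0) cone_id)) => x; rewrite scale0r.
apply: (cone_scale half_ge0 (cone_add (cone_mul cone_id) (cone_comp h h))).
Qed.

(** Iterates commute, so a difference of squares factors: each increment is half the previous
    increment composed with the sum of two iterates. Membership in [cone] then makes the sequence
    increasing as operators. *)
Lemma cone_iter_step n : cone (fun x => sqrt_iter n.+1 x - sqrt_iter n x).
Proof.
elim: n => [|n h].
  apply: (cone_ext (cone_scale half_ge0 (cone_mul cone_id))) => x /=.
  by rewrite subr0 addr0.
have c1 := cone_iter n.+1; have c0 := cone_iter n.
apply: (cone_ext (cone_scale half_ge0 (cone_comp h (cone_add c1 c0)))) => x.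
have -> : sqrt_iter n.+2 x = ((2^-1 : R)%:C)%C *: (C x + sqrt_iter n.+1 (sqrt_iter n.+1 x)) by [].
have e : sqrt_iter n.+1 x = ((2^-1 : R)%:C)%C *: (C x + sqrt_iter n (sqrt_iter n x)) by [].
rewrite [X in _ = _ - X]e !(linD (cone_linear c1)) !(linD (cone_linear c0)).
rewrite (cone_commute2 x c1 c0).
by apply: vec_eq => z; rewrite !ipE; ring.
Qed.

Lemma cone_iter_diff m n : (m <= n)%N -> cone (fun x => sqrt_iter n x - sqrt_iter m x).
Proof.
move=> /subnK <-; elim: (n - m)%N => [|k h].
  by apply: (cone_ext (cone_scale (lexx 0) cone_id)) => x; rewrite scale0r subrr.
apply: (cone_ext (cone_add (cone_iter_step (k + m)) h)) => x.
by rewrite addSn addrA subrK.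
Qed.

Lemma iter_contraction n x : nsq (sqrt_iter n x) <= nsq x.
Proof.
elim: n x => [|n h] x /=; first by rewrite /nsq ip0l nsq_ge0.
rewrite nsqZ; have := nsqD_le (C x) (sqrt_iter n (sqrt_iter n x)).
have := ctrC x; have := h x; have := h (sqrt_iter n x); rewrite expr2 => *; lra.
Qed.

(* Cauchy-Schwarz for the positive form of P. *)
Lemma cone_nsq_le P x : cone P -> (forall y, nsq (P y) <= 4 * nsq y) ->
  nsq (P x) <= 2 * ip (P x) x.
Proof.
move=> cP hP.
have cs : ip (P x) (P x) ^+ 2 <= ip (P x) x * ip (P (P x)) (P x).
  apply: discriminant_le => [|t]; first exact: cone_pos.
  have := cone_pos (x + (t%:C)%C *: P x) cP.
  rewrite (linD (cone_linear cP)) (linZ (cone_linear cP)) !ipE.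
  by rewrite (cone_selfadjoint (P x) x cP) => h; lra.
have p0 := cone_pos x cP; have n0 := nsq_ge0 (P x).
(* By [hP] the operator [P] has norm at most 2, which becomes a bound on its form by expanding
   [nsq (P (P x) - 2 P x)]. *)
have le2 : ip (P (P x)) (P x) <= 2 * nsq (P x).
  have := nsq_ge0 (P (P x) - ((2 : R)%:C)%C *: P x); rewrite nsqB nsqZ ipZr.
  by have := hP (P x); rewrite expr2 => ? ?; lra.
have [->|nz] := eqVneq (nsq (P x)) 0; first by rewrite mulr_ge0.
have np : 0 < nsq (P x) by rewrite lt0r nz.
rewrite -(ler_pM2r np) -expr2; apply: le_trans cs _.
by rewrite mulrAC mulrC ler_wpM2r.
Qed.

(** The numbers [ip (sqrt_iter n x) x] are increasing and bounded, hence Cauchy; [cone_nsq_le] turns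
    smallness of the form of a difference into smallness of its norm. *)
Lemma iter_cvg x : exists l, cvg_to (fun n => sqrt_iter n x) l.
Proof.
apply: hilbert_complete => e e0.
pose a n := ip (sqrt_iter n x) x.
have amon n : a n <= a n.+1.
  by have := cone_pos x (cone_iter_step n); rewrite ipDl ipNl -/(a n.+1) -/(a n) => ?; lra.
have ab n : a n <= nsq x.
  have := nsq_ge0 (sqrt_iter n x - x); rewrite nsqB -/(a n).
  by have := iter_contraction n x => ? ?; lra.
have e8 : 0 < e / 8 by lra.
have [N hN] := monotone_cauchy amon ab e8; exists N.
have key n : (N <= n)%N -> nsq (sqrt_iter n x - sqrt_iter N x) < e / 4.
  move=> hn; apply: le_lt_trans (cone_nsq_le x (cone_iter_diff hn) _) _.
    move=> y; have := nsqD_le (sqrt_iter n y) (- sqrt_iter N y); rewrite nsqN.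
    by have := iter_contraction n y; have := iter_contraction N y => *; lra.
  by rewrite !ipE -/(a n) -/(a N); have := hN _ hn => ?; lra.
move=> m n /key hm /key hn.
have -> : sqrt_iter m x - sqrt_iter n x =
  (sqrt_iter m x - sqrt_iter N x) + - (sqrt_iter n x - sqrt_iter N x).
  by apply: vec_eq => z; rewrite !ipE; ring.
have := nsqD_le (sqrt_iter m x - sqrt_iter N x) (- (sqrt_iter n x - sqrt_iter N x)).
by rewrite nsqN => ?; lra.
Qed.

Lemma cvg_to_bounded (X : H -> H) (u : nat -> H) l :
  bounded_op X -> cvg_to u l -> cvg_to (fun n => X (u n)) (X l).
Proof.
move=> /bounded_nsq[lX [c c0 hc]] hu e e0.
have c1 : 0 < c + 1 by lra.
have [N hN] := hu _ (divr_gt0 e0 c1); exists N => n /hN.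
rewrite ltr_pdivlMr // => h; rewrite -(linN lX) -(linD lX).
by apply: le_lt_trans (hc _) _; have := nsq_ge0 (u n - l) => ?; lra.
Qed.

(** [Y] is the strong limit of the iterates. Self-adjointness and commutation hold for each
    polynomial in [C] and pass to the limit. *)
Lemma quadratic_fixpoint : exists Y : H -> H,
  [/\ bounded_op Y, is_adjoint Y Y,
      forall x, ((2 : R)%:C)%C *: Y x = C x + Y (Y x) &
      forall X, bounded_op X -> (forall x, X (C x) = C (X x)) -> forall x, X (Y x) = Y (X x)].
Proof.
have /choice[Y hY] := iter_cvg.
have linY : is_linear Y.
  move=> a x y; apply: cvg_to_uniq (hY _) _ => e e0.
  have [N hN] := cvg_toD (cvg_to_bounded (bounded_scale a (@bounded_id R H)) (hY x)) (hY y) e0.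
  by exists N => n /hN; rewrite (cone_linear (cone_iter n)).
have ctrY x : nsq (Y x) <= nsq x.
  by apply: cvg_to_nsq_le (hY x) _ => n; apply: iter_contraction.
have bY : bounded_op Y by apply/bounded_nsq; split=> //; exists 1 => // x; rewrite mul1r.
exists Y; split=> //.
- apply: adjoint_ip => // x y; apply/eqP; rewrite -subr_eq0 -normr_le0.
  apply: (@le_eps _ _ _ 2) => // e e0.
  have [N hN] := cvg_to_ip y (hY x) e0; have [M hM] := cvg_to_ip x (hY y) e0.
  have {hN} := hN (maxn N M) (leq_maxl _ _); have {hM} := hM (maxn N M) (leq_maxr _ _).
  rewrite (cone_selfadjoint x y (cone_iter _)) (ipC x) (ipC (Y y) x) !ltr_norml => /andP[h1 h2] /andP[h3 h4].
  by rewrite add0r ler_norml; apply/andP; split; lra.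
- move=> x; apply: cvg_to_uniq.
    apply: (cvg_to_bounded (bounded_scale _ (@bounded_id R H)) (cvg_to_shift (hY x))).
  (* Strong limits respect this product because the iterates are contractions: the outer iterate
     does not enlarge the error [sqrt_iter n x - Y x]. *)
  have YY : cvg_to (fun n => sqrt_iter n (sqrt_iter n x)) (Y (Y x)).
    move=> e e0; have e4 : 0 < e / 4 by lra.
    have [N hN] := hY x _ e4; have [M hM] := hY (Y x) _ e4; exists (maxn N M) => n.
    rewrite geq_max => /andP[/hN h1 /hM h2].
    have -> : sqrt_iter n (sqrt_iter n x) - Y (Y x) =
      sqrt_iter n (sqrt_iter n x - Y x) + (sqrt_iter n (Y x) - Y (Y x)).
      by rewrite (linD (cone_linear (cone_iter n))) (linN (cone_linear (cone_iter n))) addrA subrK.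
    have := nsqD_le (sqrt_iter n (sqrt_iter n x - Y x)) (sqrt_iter n (Y x) - Y (Y x)).
    by have := iter_contraction n (sqrt_iter n x - Y x) => ? ?; lra.
  move=> e e0; have [N hN] := cvg_toD (cvg_to_cst (C x)) YY e0.
  exists N => n /hN; congr (nsq (_ - _) < e).
  by apply: vec_eq => z /=; rewrite !ipE; field.
- move=> X bX com x; apply: cvg_to_uniq (cvg_to_bounded bX (hY x)) _ => e e0.
  have [N hN] := hY (X x) _ e0; exists N => n /hN.
  by rewrite (cone_commute (proj1 bX) com (cone_iter n)).
Qed.

End SquareRoot.

(** * The square root of the defect [c A - 1 - A^2] *)

Section DefectRoot.
Set Implicit Arguments. Unset Strict Implicit.
Variables (R : realType) (H : hilbert R) (s : R) (A : H -> H).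
Hypotheses (s0 : 0 < s) (s1 : s < 1).
Hypothesis bA : bounded_op A.
Hypothesis selfA : is_adjoint A A.
Hypothesis geA : forall x, s * nsq x <= ip (A x) x.
Hypothesis leA : forall x, ip (A x) x <= s^-1 * nsq x.

Let c := s^-1 + s.

(* With P = A - s and Q = s^-1 - A, both positive, (P + Q) P Q = P Q P + Q P Q, while P + Q is a positive scalar. *)
Lemma defect_pos x : nsq (A x) + nsq x <= c * ip (A x) x.
Proof.
have linA : is_linear A by case: bA.
have sN : s != 0 by rewrite gt_eqF.
have d0 : 0 < s^-1 - s by rewrite subr_gt0 (lt_trans s1) // invf_gt1.
have h1 := leA (A x - (s%:C)%C *: x).
have h2 := geA (((s^-1)%:C)%C *: x - A x).
rewrite -subr_ge0 -(pmulr_rge0 _ d0).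
have aa y z : ip (A y) z = ip y (A z) by rewrite (adjointE _ _ selfA).
rewrite !(linE linA) !nsqB !nsqZ !ipE in h1 h2.
have e1 : ip (A (A x)) x = nsq (A x) by rewrite aa.
have e2 : ip x (A x) = ip (A x) x by rewrite ipC.
rewrite !e1 !e2 in h1 h2.
have -> : (s^-1 - s) * (c * ip (A x) x - (nsq (A x) + nsq x)) =
  (s^-1 ^+ 2 - s ^+ 2) * ip (A x) x - (s^-1 - s) * nsq (A x) - (s^-1 - s) * nsq x.
  by rewrite /c; field.
have k1 : s^-1 * (nsq (A x) - 2 * (s * ip (A x) x) + s ^+ 2 * nsq x) =
  s^-1 * nsq (A x) - 2 * ip (A x) x + s * nsq x by field.
have k2 : s * (s^-1 ^+ 2 * nsq x - 2 * (s^-1 * ip (A x) x) + nsq (A x)) =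
  s^-1 * nsq x - 2 * ip (A x) x + s * nsq (A x) by field.
rewrite k1 -/(nsq (A x)) in h1; rewrite k2 -/(nsq (A x)) in h2.
move: (s^-1) h1 h2 => k h1 h2; rewrite !expr2; lra.
Qed.

(** Centre and rescale: [c / 2] is the midpoint of the interval from [s] to [s^-1] and [D] its
    half-length. With [E = (A - c / 2) / D] the defect is [D^2 (1 - E^2)], so [B = D (1 - Y)] where
    [1 - Y] is the root of [1 - E^2]. *)
Lemma defect_root : exists B : H -> H,
  [/\ bounded_op B, is_adjoint B B,
      forall x, B (B x) = (c%:C)%C *: A x - x - A (A x) &
      forall X, bounded_op X -> (forall x, X (A x) = A (X x)) -> forall x, X (B x) = B (X x)].
Proof.
have linA : is_linear A by case: bA.
have sN : s != 0 by rewrite gt_eqF.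
have d0 : 0 < s^-1 - s by rewrite subr_gt0 (lt_trans s1) // invf_gt1.
pose D := (s^-1 - s) / 2; have Dp : 0 < D by rewrite /D; lra.
have DN : D != 0 by rewrite gt_eqF.
have D2 : D ^+ 2 = c ^+ 2 / 4 - 1 by rewrite /D /c; field.
pose E x := ((D^-1)%:C)%C *: (A x + ((- c / 2)%:C)%C *: x).
have bE : bounded_op E.
  apply: bounded_scale; apply: bounded_add => //; exact/bounded_scale/bounded_id.
have linE' : is_linear E by case: bE.
have selfE x y : ip (E x) y = ip x (E y) by rewrite !ipE (adjointE _ _ selfA).
(* As [D^2 = c^2 / 4 - 1], this is [defect_pos] after completing the square. *)
have ctrE x : nsq (E x) <= nsq x.
  rewrite nsqZ nsqD nsqZ ipZr exprVn mulrC ler_pdivrMr ?exprn_gt0 //.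
  rewrite mulrC D2; have := defect_pos x.
  have -> : (- c / 2) ^+ 2 = c ^+ 2 / 4 by field.
  by move=> ?; lra.
have linC : is_linear (fun x => E (E x)) by apply: lin_comp.
have selfC : is_adjoint (fun x => E (E x)) (fun x => E (E x)).
  by apply: adjoint_ip => // x y; rewrite !selfE.
have posC x : 0 <= ip (E (E x)) x by rewrite selfE; apply: nsq_ge0.
have ctrC x : nsq (E (E x)) <= nsq x by apply: le_trans (ctrE _) (ctrE _).
have [Y [bY selfY YY comY]] := quadratic_fixpoint linC selfC posC ctrC.
have linY : is_linear Y by case: bY.
have comE X : bounded_op X -> (forall x, X (A x) = A (X x)) -> forall x, X (E x) = E (X x).
  by move=> [lX _] com x; rewrite (linZ lX) (linD lX) (linZ lX) com.
pose B x := (D%:C)%C *: (x + (-1) *: Y x).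
have BE x : B x = (D%:C)%C *: (x - Y x) by rewrite /B scaleN1r.
have bB : bounded_op B.
  by apply/bounded_scale/bounded_add; [exact: bounded_id | exact: bounded_scale].
exists B; split=> //.
- apply: adjoint_ip => [|x y]; first by case: bB.
  by rewrite !BE !ipE (adjointE _ _ selfY).
- move=> x; rewrite !BE (linZ linY) (linD linY) (linN linY).
  apply: vec_eq => z; have := congr1 (fun v => ip v z) (YY x); rewrite !ipZl ipDl => e.
  rewrite !ipE; transitivity (D ^+ 2 * ip x z - D ^+ 2 * ip (E (E x)) z).
    transitivity (D ^+ 2 * (ip x z - 2 * ip (Y x) z + ip (Y (Y x)) z)); first by ring.
    by rewrite e; ring.
  rewrite /E !(linE linA) !ipE.
  transitivity (D ^+ 2 * ip x z - (ip (A (A x)) z - c * ip (A x) z + c ^+ 2 / 4 * ip x z)).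
    by field.
  by rewrite D2; field.
- move=> X bX com x; have [lX _] := bX.
  rewrite !BE (linZ lX) (linD lX) (linN lX) comY //.
  by move=> y; rewrite !comE.
Qed.
End DefectRoot.

(** * The orthogonal sum of two copies of [H] and its block operators *)

Section DirectSum.
Set Implicit Arguments. Unset Strict Implicit.
Variables (R : realType) (H : hilbert R).

Definition dsum_car : lmodType R[i] := (H * H)%type.
Definition dsum_inner (p q : dsum_car) : R[i] := hinner p.1 q.1 + hinner p.2 q.2.

Lemma dsum_innerDl a p q z : dsum_inner (a *: p + q) z = a * dsum_inner p z + dsum_inner q z.
Proof. by rewrite /dsum_inner !hinnerDl mulrDr addrACA. Qed.

Lemma dsum_innerC p q : dsum_inner q p = (dsum_inner p q)^*.
Proof. by rewrite /dsum_inner (hinnerC p.1) (hinnerC p.2) -rmorphD. Qed.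

Lemma dsum_inner_ge0 p : 0 <= dsum_inner p p.
Proof. by rewrite addr_ge0 // hinner_ge0. Qed.

Lemma dsum_inner_eq0 p : dsum_inner p p = 0 -> p = 0.
Proof.
move/eqP; rewrite paddr_eq0 ?hinner_ge0 // => /andP[/eqP/hinner_eq0 h1 /eqP/hinner_eq0 h2].
by case: p h1 h2 => /= ? ? -> ->.
Qed.

Lemma dsum_Re (p q : dsum_car) : complex.Re (dsum_inner p q) = ip p.1 q.1 + ip p.2 q.2.
Proof. by rewrite /dsum_inner /ip; case: (hinner p.1 q.1) (hinner p.2 q.2) => ? ? []. Qed.

Lemma dsum_complete (u : nat -> dsum_car) :
  (forall e : R, 0 < e -> exists N : nat, forall m n : nat, (N <= m)%N -> (N <= n)%N ->
      Num.sqrt (complex.Re (dsum_inner (u m - u n) (u m - u n))) < e) ->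
  exists l : dsum_car, forall e : R, 0 < e -> exists N : nat, forall n : nat, (N <= n)%N ->
      Num.sqrt (complex.Re (dsum_inner (u n - l) (u n - l))) < e.
Proof.
have sqE (p : dsum_car) (e : R) : 0 < e ->
    (Num.sqrt (complex.Re (dsum_inner p p)) < e) = (nsq p.1 + nsq p.2 < e ^+ 2).
  move=> e0; rewrite dsum_Re -/(nsq _) -/(nsq _).
  have p0 : 0 <= nsq p.1 + nsq p.2 by rewrite addr_ge0 ?nsq_ge0.
  by rewrite -[X in _ = (X < _)]sqr_sqrtr // ltr_pXn2r ?nnegrE ?sqrtr_ge0 ?(ltW e0).
move=> hu.
have cauchy (e : R) : 0 < e -> exists N : nat, forall m n, (N <= m)%N -> (N <= n)%N ->
    nsq ((u m).1 - (u n).1) + nsq ((u m).2 - (u n).2) < e.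
  move=> e0; have s0 : 0 < Num.sqrt e by rewrite sqrtr_gt0.
  have [N hN] := hu _ s0; exists N => m n hm hn.
  by have := hN m n hm hn; rewrite sqE // sqr_sqrtr // ltW.
have [|l1 hl1] := @hilbert_complete _ H (fun n => (u n).1).
  move=> e /cauchy[N hN]; exists N => m n hm hn; have := hN m n hm hn.
  by have := nsq_ge0 ((u m).2 - (u n).2) => ? ?; lra.
have [|l2 hl2] := @hilbert_complete _ H (fun n => (u n).2).
  move=> e /cauchy[N hN]; exists N => m n hm hn; have := hN m n hm hn.
  by have := nsq_ge0 ((u m).1 - (u n).1) => ? ?; lra.
exists (l1, l2) => e e0.
have e2 : 0 < e ^+ 2 / 2 by rewrite divr_gt0 ?exprn_gt0.
have [N hN] := hl1 _ e2; have [M hM] := hl2 _ e2; exists (maxn N M) => n.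
rewrite geq_max => /andP[/hN h1 /hM h2]; rewrite sqE //=; lra.
Qed.

Definition dsum : hilbert R :=
  Hilbert dsum_innerDl dsum_innerC dsum_inner_ge0 dsum_inner_eq0 dsum_complete.

Lemma ip_dsum (p q : dsum) : ip p q = ip p.1 q.1 + ip p.2 q.2.
Proof. exact: dsum_Re. Qed.

Lemma nsq_dsum (p : dsum) : nsq p = nsq p.1 + nsq p.2.
Proof. exact: ip_dsum. Qed.

Definition diag_op (T : H -> H) (p : dsum) : dsum := (T p.1, T p.2).

Definition block_op (P Q S T : H -> H) (p : dsum) : dsum :=
  (P p.1 + Q p.2, S p.1 + T p.2).

Lemma block_bounded P Q S T : bounded_op P -> bounded_op Q -> bounded_op S -> bounded_op T ->
  bounded_op (block_op P Q S T).
Proof.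
move=> /bounded_nsq[lP [p p0 hp]] /bounded_nsq[lQ [q q0 hq]] /bounded_nsq[lS [s s0 hs]]
  /bounded_nsq[lT [t t0 ht]]; apply/bounded_nsq; split.
  move=> a x y; rewrite /block_op /= lP lQ lS lT.
  by apply: injective_projections; rewrite /= scalerDr addrACA.
exists (2 * (p + q + s + t)) => [|x]; first by rewrite mulr_ge0 // !addr_ge0.
rewrite !nsq_dsum /=.
have := nsqD_le (P x.1) (Q x.2); have := nsqD_le (S x.1) (T x.2).
have := hp x.1; have := hq x.2; have := hs x.1; have := ht x.2.
have n1 := nsq_ge0 x.1; have n2 := nsq_ge0 x.2 => h1 h2 h3 h4 h5 h6.
have := mulr_ge0 p0 n2; have := mulr_ge0 q0 n1; have := mulr_ge0 s0 n2; have := mulr_ge0 t0 n1.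
by move=> *; lra.
Qed.

Lemma block_adjoint P Q S T P' Q' S' T' :
  bounded_op P -> bounded_op Q -> bounded_op S -> bounded_op T ->
  is_adjoint P P' -> is_adjoint Q Q' -> is_adjoint S S' -> is_adjoint T T' ->
  is_adjoint (block_op P Q S T) (block_op P' S' Q' T').
Proof.
move=> bP bQ bS bT hP hQ hS hT; apply: adjoint_ip => [|x y].
  by case: (block_bounded bP bQ bS bT).
rewrite !ip_dsum /= !ipE (adjointE _ _ hP) (adjointE _ _ hQ) (adjointE _ _ hS) (adjointE _ _ hT).
ring.
Qed.

Lemma block_diag_commute P Q S T (X : H -> H) : is_linear X ->
  (forall x, X (P x) = P (X x)) -> (forall x, X (Q x) = Q (X x)) ->
  (forall x, X (S x) = S (X x)) -> (forall x, X (T x) = T (X x)) ->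
  forall p, diag_op X (block_op P Q S T p) = block_op P Q S T (diag_op X p).
Proof. by move=> lX hP hQ hS hT p; rewrite /diag_op /block_op /= !(linD lX) hP hQ hS hT. Qed.

Lemma diag_block (T : H -> H) : diag_op T = block_op T (fun=> 0) (fun=> 0) T.
Proof. by apply: funext => p; rewrite /block_op addr0 add0r. Qed.

Lemma bounded_0 : bounded_op (fun _ : H => 0 : H).
Proof.
apply/bounded_nsq; split; first by move=> a x y; rewrite scaler0 addr0.
by exists 0 => // x; rewrite mul0r /nsq ip0l.
Qed.

Lemma adjoint_0 : is_adjoint (fun _ : H => 0 : H) (fun _ : H => 0 : H).
Proof. by apply: adjoint_ip => [|x y]; [case: bounded_0 | rewrite ip0l ip0r]. Qed.

Lemma diag_bounded T : bounded_op T -> bounded_op (diag_op T).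
Proof. by move=> bT; rewrite diag_block; apply: block_bounded => //; apply: bounded_0. Qed.

Lemma diag_adjoint T Ta : bounded_op T -> is_adjoint T Ta -> is_adjoint (diag_op T) (diag_op Ta).
Proof.
move=> bT hT; rewrite !diag_block.
by apply: block_adjoint => //; (exact: bounded_0 || exact: adjoint_0).
Qed.

End DirectSum.

(** * The quantum annulus, the boundary equation and the dilation *)

Section QuantumAnnulus.
Set Implicit Arguments. Unset Strict Implicit.
Variables (R : realType) (r : R).
Hypotheses (r0 : 0 < r) (r1 : r < 1).
Implicit Types (H K : hilbert R).

(** Adjoints are given by a relation, hence the quantification; [boundary_eq_intro] reduces the
    check to a single choice of adjoints. *)
Definition boundary_eq K (J Ji : K -> K) := forall Ja Jia : K -> K,
  is_adjoint J Ja -> is_adjoint Ji Jia -> forall y : K,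
  (((r ^- 2 + r ^+ 2)%:C)%C : R[i]) *: y - Ja (J y) - Ji (Jia y) = 0.

Lemma boundary_eq_intro K (J Ji Ja Jia : K -> K) :
  is_adjoint J Ja -> is_adjoint Ji Jia ->
  (forall y, (((r ^- 2 + r ^+ 2)%:C)%C : R[i]) *: y - Ja (J y) - Ji (Jia y) = 0) ->
  boundary_eq J Ji.
Proof.
move=> hJ hJi h Ja' Jia' hJ' hJi' y.
by rewrite (adjoint_unique _ hJ' hJ) (adjoint_unique _ hJi' hJi) h.
Qed.

Lemma sqr_lt1 : r ^+ 2 < 1.
Proof. by rewrite expr_lt1 // ltW. Qed.

Lemma rnorm_nsq H (T : H -> H) : rnorm_le1 r T <-> forall x, nsq (T x) <= r ^- 2 * nsq x.
Proof.
have r20 : 0 < r ^+ 2 by rewrite exprn_gt0.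
have E x : (r * hnorm (T x) <= hnorm x) = (nsq (T x) <= r ^- 2 * nsq x).
  rewrite -(@ler_pXn2r _ 2) ?nnegrE ?hnorm_ge0 ?mulr_ge0 ?hnorm_ge0 ?(ltW r0) //.
  by rewrite exprMn !hnorm_sq mulrC -ler_pdivlMr // mulrC.
by split=> h x; have := h x; rewrite E.
Qed.

Lemma adjoint_inverse K (J Ji Ja Jia : K -> K) :
  is_adjoint J Ja -> is_adjoint Ji Jia -> (forall x, Ji (J x) = x) -> forall y, Ja (Jia y) = y.
Proof.
move=> hJ hJi h y; apply: (adjoint_unique y (adjoint_comp hJi hJ)) => u v.
by rewrite h.
Qed.

(* M = J^* J is a root of M^2 - (r^2 + r^-2) M + 1, so (M - r^2)^2 and (M - r^-2)^2 are positive multiples of M - r^2 and r^-2 - M. *)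
Lemma boundary_eq_QA K (J Ji : K -> K) :
  inverse_pair J Ji -> boundary_eq J Ji -> in_QA r J Ji.
Proof.
move=> [bJ bJi JiJ JJi] hJ.
have [Ja hJa] := adjoint_exists bJ; have [Jia hJia] := adjoint_exists bJi.
have r20 : 0 < r ^+ 2 by rewrite exprn_gt0.
have rN : r ^+ 2 != 0 by rewrite gt_eqF.
pose s := r ^+ 2; pose k := r ^- 2.
have sk : s * k = 1 by rewrite /s /k mulfV.
have ks : 0 < k - s by rewrite /k /s subr_gt0 (lt_trans sqr_lt1) // invf_gt1 // sqr_lt1.
have bounds y : s * nsq y <= nsq (J y) <= k * nsq y.
  have a : ip (Ja (J y)) y = nsq (J y) by rewrite ipC -(adjointE _ _ hJa).
  (* The boundary equation is evaluated at [Ja (J y)], where [Ji] after [Jia] gives back [y], and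
     then paired with [y]. *)
  have b : nsq (Ja (J y)) = (k + s) * nsq (J y) - nsq y.
    have := hJ _ _ hJa hJia (Ja (J y)).
    rewrite (adjoint_inverse hJia hJa JJi) JiJ => /(congr1 (fun v => ip v y)).
    rewrite !ipE a -/(nsq y) -/k -/s.
    have -> : ip (Ja (J (Ja (J y)))) y = nsq (Ja (J y)).
      by rewrite (adjointE _ _ (adjoint_sym hJa)) (adjointE _ _ hJa).
    by move=> e; lra.
  have e1 : nsq (Ja (J y) - (s%:C)%C *: y) = (k - s) * (nsq (J y) - s * nsq y).
    rewrite nsqB nsqZ ipZr a b; transitivity ((k - s) * nsq (J y) + (s ^+ 2 - s * k) * nsq y).
      by rewrite sk; ring.
    by ring.
  have e2 : nsq (Ja (J y) - (k%:C)%C *: y) = (k - s) * (k * nsq y - nsq (J y)).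
    rewrite nsqB nsqZ ipZr a b; transitivity (- (k - s) * nsq (J y) + (k ^+ 2 - s * k) * nsq y).
      by rewrite sk; ring.
    by ring.
  have := nsq_ge0 (Ja (J y) - (s%:C)%C *: y); have := nsq_ge0 (Ja (J y) - (k%:C)%C *: y).
  by rewrite e1 e2 !pmulr_rge0 // !subr_ge0 => -> ->.
split; apply/rnorm_nsq => y; first by case/andP: (bounds y).
have /andP[h _] := bounds (Ji y); rewrite JJi in h.
by rewrite mulrC ler_pdivlMr // mulrC.
Qed.

(** The upper triangular operator of the overview. The last clause lets the rest of the tuple be
    lifted diagonally: whatever commutes with [T] and its adjoint commutes with [A], hence with [B]
    and with all entries of [J]. *)
Lemma block_dilation H (T Ti : H -> H) : inverse_pair T Ti -> in_QA r T Ti ->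
  exists J Ji : dsum H -> dsum H,
  [/\ inverse_pair J Ji, boundary_eq J Ji, forall x, J (x, 0) = (T x, 0) &
      forall X, bounded_op X -> (forall x, X (T x) = T (X x)) ->
        (forall Ta, is_adjoint T Ta -> forall x, X (Ta x) = Ta (X x)) ->
        forall p, diag_op X (J p) = J (diag_op X p)].
Proof.
move=> [bT bTi TiT TTi] [/rnorm_nsq leT /rnorm_nsq leTi].
have [Ta hTa] := adjoint_exists bT; have [Tia hTia] := adjoint_exists bTi.
have bTa := adjoint_bounded bT hTa; have bTia := adjoint_bounded bTi hTia.
have TaTia := adjoint_inverse hTa hTia TiT; have TiaTa := adjoint_inverse hTia hTa TTi.
have r20 : 0 < r ^+ 2 by rewrite exprn_gt0.
pose A x := Ta (T x).
have bA : bounded_op A := bounded_comp bTa bT.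
have selfA : is_adjoint A A := adjoint_comp (adjoint_sym hTa) hTa.
have Axx x : ip (A x) x = nsq (T x) by rewrite ipC -(adjointE _ _ hTa).
(* The lower bound is the norm bound on [Ti] applied at [T x]. *)
have geA x : r ^+ 2 * nsq x <= ip (A x) x.
  by rewrite Axx mulrC -ler_pdivlMr // mulrC -{1}[x]TiT.
have leA x : ip (A x) x <= r ^- 2 * nsq x by rewrite Axx.
have [B [bB selfB BB comB]] := defect_root r20 sqr_lt1 bA selfA geA leA.
have [lT _] := bT; have [lTi _] := bTi; have [lTa _] := bTa; have [lTia _] := bTia; have [lB _] := bB.
(* The corner of the inverse of a triangular block: minus the inverse of [T], times the corner
   [Tia B] of [J], times [Ta], the inverse of [Tia]. *)
pose F x := (-1) *: Ti (Tia (B (Ta x))).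
have bF : bounded_op F.
  by apply: bounded_scale; do 3! (apply: bounded_comp => //).
pose Fa x := (-1) *: T (B (Ti (Tia x))).
have hFa : is_adjoint F Fa.
  apply: adjoint_ip => [|x y]; first by case: bF.
  rewrite /F /Fa !scaleN1r !ipE (adjointE _ _ hTia) (adjointE _ _ (adjoint_sym hTia)).
  by rewrite (adjointE _ _ selfB) (adjointE _ _ (adjoint_sym hTa)).
pose G x := Tia (B x).
have bG : bounded_op G by apply: bounded_comp.
have hG : is_adjoint G (fun x => B (Ti x)) := adjoint_comp (adjoint_sym hTia) selfB.
pose J := block_op T G (fun=> 0) Tia; pose Ji := block_op Ti F (fun=> 0) Ta.
have b0 := @bounded_0 R H; have a0 := @adjoint_0 R H.
have hJa : is_adjoint J (block_op Ta (fun=> 0) (fun x => B (Ti x)) Ti).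
  by apply: block_adjoint => //; apply: adjoint_sym.
have hJia : is_adjoint Ji (block_op Tia (fun=> 0) Fa T).
  by apply: block_adjoint => //; apply: adjoint_sym.
exists J, Ji; split.
- split; [exact: block_bounded|exact: block_bounded|move=> p|move=> p];
    rewrite /J /Ji /block_op /F /G /= !add0r !scaleN1r;
    case: p => x y /=; congr (_, _); rewrite ?TaTia ?TiaTa //.
    by rewrite (linD lTi) TiT addrK.
  by rewrite (linD lT) (linN lT) !TTi subrK.
- apply: boundary_eq_intro hJa hJia _ => -[x y].
  (* [N] is the inverse of [A] and commutes with [B], so [N B^2 = c - N - A] with [c = r^-2 + r^2].
     The diagonal entries of the two products then add up to [c], and the off-diagonal entries [B]
     and [- B] cancel. *)
  pose N z := Ti (Tia z).
  have NA z : N (A z) = z by rewrite /N /A TiaTa TiT.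
  have AN z : A (N z) = z by rewrite /N /A TTi TaTia.
  have BA z : B (A z) = A (B z) by rewrite comB.
  have BN z : B (N z) = N (B z) by rewrite -[B (N z)]NA -BA AN.
  have lN : is_linear N by apply: lin_comp.
  have FE z : F z = - N (B (Ta z)) by rewrite /F scaleN1r.
  have FaE z : Fa z = - T (B (N z)) by rewrite /Fa scaleN1r.
  have TTaE z : Ta (T z) = A z by [].
  have TTiaE z : Ti (Tia z) = N z by [].
  have GE z : G z = Tia (B z) by [].
  have e1 : Ta (T x + G y) = A x + B y by rewrite (linD lTa) GE TaTia TTaE.
  have e2 : Ti (T x + G y) = x + N (B y) by rewrite (linD lTi) GE TiT TTiaE.
  have e3 : F (Fa x + T y) = N (B (B x)) - B y.
    rewrite FE FaE (linD lTa) (linN lTa) !TTaE (linD lB) (linN lB) (linD lN) (linN lN).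
    by rewrite -(BA (N x)) AN (BA y) NA opprD !opprK.
  have e4 : Ta (Fa x + T y) = A y - B x.
    by rewrite FaE (linD lTa) (linN lTa) !TTaE -(BA (N x)) AN addrC.
  have -> : block_op Ta (fun=> 0) (fun x => B (Ti x)) Ti (J (x, y)) =
    (A x + B y, B (x + N (B y)) + N y).
    by rewrite /J /block_op /= addr0 add0r e1 e2.
  have -> : Ji (block_op Tia (fun=> 0) Fa T (x, y)) =
    (N x + (N (B (B x)) - B y), A y - B x).
    by rewrite /Ji /block_op /= addr0 add0r e3 e4.
  rewrite (linD lB) (BN (B y)) !BB !(linD lN) !(linN lN) !(linZ lN) !NA.
  by congr (_, _); apply: vec_eq => z; rewrite /= !ipE; ring.
- move=> x; rewrite /J /block_op /G /=.
  by rewrite (lin0 lB) (lin0 lTia) !addr0.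
- move=> X bX comT comTa p; have [lX _] := bX.
  have comTia x : X (Tia x) = Tia (X x).
    by rewrite -[RHS](congr1 Tia (congr1 X (TaTia x))) (comTa _ hTa) TiaTa.
  apply: block_diag_commute => // [x|x]; last exact: lin0.
  by rewrite /G comTia comB // => y; rewrite /A (comTa _ hTa) comT.
Qed.

(** The invariant that each enlargement of the space must preserve. *)
Definition QA_tuple H d (T Ti : 'I_d -> H -> H) :=
  [/\ forall m, inverse_pair (T m) (Ti m), doubly_commuting T & forall m, in_QA r (T m) (Ti m)].

Lemma diag_inverse_pair H (T Ti : H -> H) :
  inverse_pair T Ti -> inverse_pair (diag_op T) (diag_op Ti).
Proof.
move=> [bT bTi TiT TTi]; split; [exact: diag_bounded|exact: diag_bounded|move=> p|move=> p];
  by case: p => x y; rewrite /diag_op /= ?TiT ?TTi.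
Qed.

Lemma diag_QA H (T Ti : H -> H) : in_QA r T Ti -> in_QA r (diag_op T) (diag_op Ti).
Proof.
move=> [/rnorm_nsq h1 /rnorm_nsq h2]; split; apply/rnorm_nsq => p;
  by rewrite !nsq_dsum mulrDr lerD ?h1 ?h2.
Qed.

Lemma diag_boundary_eq H (T Ti : H -> H) :
  inverse_pair T Ti -> boundary_eq T Ti -> boundary_eq (diag_op T) (diag_op Ti).
Proof.
move=> [bT bTi _ _] h.
have [Ta hTa] := adjoint_exists bT; have [Tia hTia] := adjoint_exists bTi.
apply: boundary_eq_intro (diag_adjoint bT hTa) (diag_adjoint bTi hTia) _ => -[x y].
by rewrite /diag_op /=; congr (_, _); rewrite h.
Qed.

(** Only the entry [m0] is dilated, the others act diagonally. Boundary equations already achieved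
    are kept, so the step can be repeated over all indices. *)
Lemma dilation_step H d (T Ti : 'I_d -> H -> H) (m0 : 'I_d) : QA_tuple T Ti ->
  exists J Ji : 'I_d -> dsum H -> dsum H,
  [/\ QA_tuple J Ji, forall m x, J m (x, 0) = (T m x, 0) &
      forall m, m = m0 \/ boundary_eq (T m) (Ti m) -> boundary_eq (J m) (Ji m)].
Proof.
move=> [invT [comT dcomT] QAT].
have bT m : bounded_op (T m) by case: (invT m).
have /choice[Ta hTa] : forall m, exists S, is_adjoint (T m) S.
  by move=> m; apply: adjoint_exists.
have [J0 [Ji0 [invJ0 eqJ0 J0E comJ0]]] := block_dilation (invT m0) (QAT m0).
pose J m := if m == m0 then J0 else diag_op (T m).
pose Ji m := if m == m0 then Ji0 else diag_op (Ti m).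
have invJ m : inverse_pair (J m) (Ji m).
  by rewrite /J /Ji; case: eqP => // _; apply: diag_inverse_pair.
have [bJ0 _ _ _] := invJ0; have [J0a hJ0a] := adjoint_exists bJ0.
pose Ja m := if m == m0 then J0a else diag_op (Ta m).
have hJa m : is_adjoint (J m) (Ja m).
  by rewrite /J /Ja; case: eqP => // _; apply: diag_adjoint.
have dcT i j x : i != j -> T i (Ta j x) = Ta j (T i x).
  by move=> ij; apply: dcomT ij _ (hTa j) _.
have aaT i j x : Ta i (Ta j x) = Ta j (Ta i x).
  exact: (adjoint_commute (hTa i) (hTa j) (comT i j)).
have comTJ0 m p : m != m0 -> diag_op (T m) (J0 p) = J0 (diag_op (T m) p).
  move=> mm0; apply: comJ0 => // Ta0 hTa0 x.
  by rewrite !(adjoint_unique _ hTa0 (hTa m0)) dcT.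
have comTaJ0 m p : m != m0 -> diag_op (Ta m) (J0 p) = J0 (diag_op (Ta m) p).
  move=> mm0; apply: comJ0; first exact: adjoint_bounded (hTa m).
    by move=> x; rewrite dcT // eq_sym.
  by move=> Ta0 hTa0 x; rewrite !(adjoint_unique _ hTa0 (hTa m0)) aaT.
(* The adjoint of the relation [comTaJ0], since [diag_op (T m)] is the adjoint of
   [diag_op (Ta m)]. *)
have comTJ0a m p : m != m0 -> diag_op (T m) (J0a p) = J0a (diag_op (T m) p).
  move=> mm0; apply: (adjoint_commute (adjoint_sym (diag_adjoint (bT m) (hTa m))) hJ0a) => q.
  exact: comTaJ0.
exists J, Ji; split.
- split=> //; last first.
    move=> m; rewrite /J /Ji; case: eqP => _; last exact: diag_QA.
    (* The new entry stays in the annulus because its boundary equation forces it. *)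
    exact: boundary_eq_QA.
  split=> [i j p|i j ij S hS p].
    rewrite /J; case: (eqVneq i m0) (eqVneq j m0) => [_|ni] [_|nj] //.
    + by rewrite comTJ0.
    + by rewrite comTJ0.
    + by rewrite /diag_op /= !(comT i j).
  rewrite !(adjoint_unique _ hS (hJa j)) /J /Ja.
  case: (eqVneq i m0) ij => [->|ni] ij; case: (eqVneq j m0) ij => [ej|nj] ij //.
  + by rewrite comTaJ0.
  + by rewrite comTJ0a.
  + by rewrite /diag_op /= !dcT.
- move=> m x; rewrite /J; case: eqP => [->|_] //.
  by rewrite /diag_op /= (lin0 (proj1 (bT m))).
- move=> m; rewrite /J /Ji; case: eqP => [_ _|nm] //.
  by case=> // h; apply: diag_boundary_eq.
Qed.

Lemma dsum_inl_isometry H : is_isometry (fun x : H => (x, 0) : dsum H).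
Proof.
split; first by move=> a x y; apply: injective_projections; rewrite //= scaler0 addr0.
by move=> x; rewrite /hnorm -/(ip _ _) -/(ip _ _) ip_dsum /= ip0l addr0.
Qed.

Lemma extension_exists H d (T Ti : 'I_d -> H -> H) (l : seq 'I_d) : QA_tuple T Ti ->
  exists (K : hilbert R) (V : H -> K) (J Ji : 'I_d -> K -> K),
  [/\ is_isometry V, QA_tuple J Ji, forall m x, J m (V x) = V (T m x) &
      forall m, m \in l -> boundary_eq (J m) (Ji m)].
Proof.
move=> hT; elim: l => [|m0 l [K [V [J [Ji [isoV hJ JV hl]]]]]].
  by exists H, (fun x => x), T, Ti.
have [J' [Ji' [hJ' J'E bJ']]] := dilation_step m0 hJ.
have [linW isoW] := dsum_inl_isometry K; have [linV nV] := isoV.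
exists (dsum K), (fun x => (V x, 0)), J', Ji'; split=> //.
- split; first exact: (lin_comp linW linV).
  by move=> x; rewrite isoW nV.
- by move=> m x; rewrite J'E JV.
- by move=> m; rewrite inE => /orP[/eqP|/hl] h; apply: bJ'; [left|right].
Qed.

Lemma zpow_intertwine H K (V : H -> K) T Ti J Ji :
  inverse_pair T Ti -> inverse_pair J Ji -> (forall x, J (V x) = V (T x)) ->
  forall n x, zpow J Ji n (V x) = V (zpow T Ti n x).
Proof.
move=> [_ _ TiT TTi] [_ _ JiJ JJi] h.
(* Intertwining passes to the inverses, which covers the negative powers. *)
have hi x : Ji (V x) = V (Ti x) by rewrite -{1}[x]TTi -h JiJ.
have it (f : H -> H) (g : K -> K) : (forall x, g (V x) = V (f x)) ->
    forall k x, iter k g (V x) = V (iter k f x).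
  by move=> e; elim=> [|k IH] x //=; rewrite IH e.
by case=> k x; apply: it.
Qed.

Lemma multipow_intertwine H K d (V : H -> K) (T Ti : 'I_d -> H -> H) (J Ji : 'I_d -> K -> K) :
  (forall m, inverse_pair (T m) (Ti m)) -> (forall m, inverse_pair (J m) (Ji m)) ->
  (forall m x, J m (V x) = V (T m x)) ->
  forall n x, multipow J Ji n (V x) = V (multipow T Ti n x).
Proof.
move=> hT hJ h n x; rewrite /multipow; elim: (enum _) => //= i l ->.
exact: zpow_intertwine.
Qed.

(** Extracts a one-variable dilation from the joint one; used in the converse with exponents 1 and
    -1. *)
Lemma multipow_single H d (T Ti : 'I_d -> H -> H) (m : 'I_d) (k : int) x :
  multipow T Ti (fun i => if i == m then k else 0) x = zpow (T m) (Ti m) k x.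
Proof.
rewrite /multipow; have : m \in enum 'I_d by rewrite mem_enum.
have := enum_uniq 'I_d; elim: (enum _) => //= i l IH /andP[il ul].
rewrite inE; case: (eqVneq i m) il => [-> ml _|im il].
  congr (zpow _ _ _ _); move: ml {IH ul}; elim: l => //= j l IH.
  by rewrite inE negb_or eq_sym => /andP[/negPf -> /IH ->].
exact: IH ul.
Qed.

(** [nsq (y - V (Vs y))] equals [nsq y - nsq (Vs y)] and is nonnegative. *)
Lemma isometry_adjoint_contraction H K (V : H -> K) Vs y :
  is_isometry V -> is_adjoint V Vs -> hnorm (Vs y) <= hnorm y.
Proof.
move=> [lV nV] hVs; rewrite -(@ler_pXn2r _ 2) ?nnegrE ?hnorm_ge0 // !hnorm_sq.
have := nsq_ge0 (y - V (Vs y)); rewrite nsqB -[nsq (V _)]hnorm_sq nV hnorm_sq.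
by rewrite ipC (adjointE _ _ hVs) -/(nsq (Vs y)) => ?; lra.
Qed.

End QuantumAnnulus.

Theorem theorem1p3 (R : realType) (r : R) (H : hilbert R) (d : nat)
    (T Ti : 'I_d -> H -> H) :
  0 < r -> r < 1 ->
  (forall m : 'I_d, inverse_pair (T m) (Ti m)) ->
  doubly_commuting T ->
  (forall m : 'I_d, in_QA r (T m) (Ti m)) <->
  (exists (K : hilbert R) (V : H -> K) (J Ji : 'I_d -> K -> K),
     [/\ is_isometry V,
         (forall m : 'I_d, inverse_pair (J m) (Ji m)),
         doubly_commuting J,
         (forall Vs : K -> H, is_adjoint V Vs ->
            forall (n : 'I_d -> int) (x : H),
              multipow T Ti n x = Vs (multipow J Ji n (V x))) &
         (forall m : 'I_d, forall Ja Jia : K -> K,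
            is_adjoint (J m) Ja -> is_adjoint (Ji m) Jia ->
            forall y : K,
              (((r ^- 2 + r ^+ 2)%:C)%C : R[i]) *: y - Ja (J m y) - Ji m (Jia y) = 0)]).
Proof.
move=> r0 r1 invT dcT; split=> [QAT|[K [V [J [Ji [isoV invJ _ dil eqJ]]]]] m].
  have [|K [V [J [Ji [isoV [invJ dcJ _] JV eqJ]]]]] :=
    @extension_exists R r r0 r1 H d T Ti (enum 'I_d) _; first by split.
  exists K, V, J, Ji; split=> //; last by move=> m; apply: eqJ; rewrite mem_enum.
  move=> Vs hVs n x; rewrite (multipow_intertwine invT invJ JV).
  apply: vec_eq => z; rewrite [RHS]ipC -(adjointE _ _ hVs).
  have [lV nV] := isoV.
  (* Polarisation: it shows that [Vs] is a left inverse of [V], so the extension is a dilation. *)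
  have polar (u v : H) : ip (V u) (V v) = ip u v.
    have nE w : nsq (V w) = nsq w by rewrite -!hnorm_sq nV.
    by have := nE (u + v); rewrite (linD lV) !nsqD !nE => ?; lra.
  by rewrite polar ipC.
have [Vs hVs] : exists Vs, is_adjoint V Vs.
  apply: adjoint_exists; case: isoV => lV nV; split=> //; exists 1 => x.
  by rewrite nV mul1r.
have [J1 J2] := @boundary_eq_QA R r r0 r1 K (J m) (Ji m) (invJ m) (eqJ m).
have [_ nV] := isoV.
have single k x : zpow (T m) (Ti m) k x = Vs (zpow (J m) (Ji m) k (V x)).
  by rewrite -!multipow_single (dil Vs hVs).
have bound k : rnorm_le1 r (zpow (J m) (Ji m) k) -> rnorm_le1 r (zpow (T m) (Ti m) k).
  move=> h x; rewrite single -[hnorm x]nV; apply: le_trans (h (V x)).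
  by rewrite ler_wpM2l ?(ltW r0) // (isometry_adjoint_contraction _ isoV hVs).
(* [zpow] at 1 and at -1 computes to the operator and its inverse. *)
by split; [exact: (bound 1) | exact: (bound (-1))].
Qed.
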